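(* Let $c>0$, $\eta>0$, $\delta\ge 0$, and let $B=B(0,1)\subset\mathbb{R}^2$ be the unit disk. Let $\{\psi_{m,n,\ell}(\cdot;c)\}_{m,n\in\mathbb{N},\,\ell\in\mathbb{I}(m)}$ be the disk prolate spheroidal wave functions with bandwidth parameter $c$ and $\alpha_{m,n}(c)$ the corresponding prolate eigenvalues. Suppose $q\in \mathrm{span}\{\psi_{m,n,\ell}(\cdot;c) : |\alpha_{m,n}(c)|>\eta\}$, let $$u(x)=\int_{B} e^{ic\,x\cdot y}\,q(y)\,dy,\qquad x\in B,$$ and let $u^\delta\in L^2(B)$ satisfy $\|u^\delta-u\|_{L^2(B)}\le\delta$. Define $$q^\eta=\sum_{|\alpha_{m,n}(c)|>\eta}\frac{1}{\alpha_{m,n}(c)}\,\big\langle u^\delta,\psi_{m,n,\ell}(\cdot;c)\big\rangle_{B}\,\psi_{m,n,\ell}(\cdot;c),$$ where the sum runs over all $m,n\in\mathbb{N}$ and $\ell\in\mathbb{I}(m)$ with $|\alpha_{m,n}(c)|>\eta$. Then $$\|q^\eta-q\|_{L^2(B)}\le\frac{\delta}{\eta}.$$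
   Context: Here $\mathbb{N}=\{0,1,2,\dots\}$, $\mathbb{I}(0)=\{1\}$ and $\mathbb{I}(m)=\{1,2\}$ for $m\ge1$. $L^2(B)$ is the space of complex-valued square-integrable functions on the unit disk $B$, and $\langle f,g\rangle_B=\int_B f(x)\overline{g(x)}\,dx$ is its inner product. For $c>0$, the disk prolate spheroidal wave functions (disk PSWFs) $\psi_{m,n,\ell}(\cdot;c)$, $m,n\in\mathbb{N}$, $\ell\in\mathbb{I}(m)$, are Slepian's real-valued eigenfunctions of the restricted Fourier integral operator on $B$: $$\int_{B}e^{ic\,x\cdot y}\,\psi_{m,n,\ell}(y;c)\,dy=\alpha_{m,n}(c)\,\psi_{m,n,\ell}(x;c),\qquad x\in B,$$ where $\alpha_{m,n}(c)\in\mathbb{C}$ (independent of $\ell$) are called the prolate eigenvalues. They have the form $\psi_{m,n,\ell}(x;c)=r^m\varphi_{m,n}(2r^2-1;c)Y_{m,\ell}(\theta)$ in polar coordinates $x=(r\cos\theta,r\sin\theta)$, with $Y_{0,1}=1/\sqrt{2\pi}$, $Y_{m,1}=\cos(m\theta)/\sqrt{\pi}$, $Y_{m,2}=\sin(m\theta)/\sqrt{\pi}$ for $m\ge1$. They are simultaneously eigenfunctions of the Sturm-Liouville operator $$\mathcal{D}_c=-(1-r^2)\partial_r^2-\frac1r\partial_r+3r\partial_r-\frac1{r^2}\partial_\theta^2+c^2r^2,$$ with eigenvalues $\chi_{m,n}(c)$ satisfying $0<\chi_{m,0}(c)<\chi_{m,1}(c)<\cdots$ for each fixed $m$. Known standing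 facts about this system: for every $c>0$, $\{\psi_{m,n,\ell}(\cdot;c)\}$ is a complete orthonormal system of $L^2(B)$; every $\alpha_{m,n}(c)$ is nonzero; for fixed $m$, $|\alpha_{m,n_1}(c)|>|\alpha_{m,n_2}(c)|$ whenever $n_1<n_2$; and $|\alpha_{m,n}(c)|\to0$ as $m,n\to\infty$. *)

(* Defs.v *)
From HB Require Import structures.
From mathcomp Require Import all_boot all_order all_algebra.
From mathcomp Require Import finmap complex.
From mathcomp Require Import all_classical all_reals all_analysis.

Set Implicit Arguments.
Unset Strict Implicit.
Unset Printing Implicit Defensive.

Import Order.TTheory GRing.Theory Num.Theory.
Import numFieldNormedType.Exports.

Local Open Scope classical_set_scope.
Local Open Scope ring_scope.
Local Open Scope complex_scope.

Notation cmod := ComplexField.Normc.normc.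

Definition leb2 (R : realType) :=
  (@lebesgue_measure R \x @lebesgue_measure R)%E.

Definition disk (R : realType) : set (R * R) :=
  [set x | x.1 ^+ 2 + x.2 ^+ 2 < 1].

Definition cexpi (R : realType) (t : R) : R[i] := cos t +i* sin t.

Definition disk_int (R : realType) (f : R * R -> R[i]) : R[i] :=
  Rintegral (@leb2 R) (@disk R) (fun x => complex.Re (f x)) +i*
  Rintegral (@leb2 R) (@disk R) (fun x => complex.Im (f x)).

Definition disk_inner (R : realType) (f g : R * R -> R[i]) : R[i] :=
  disk_int (fun x => f x * (g x)^*).

(* Extended-real valued, hence meaningful also outside L^2(B). *)
Definition disk_norm (R : realType) (f : R * R -> R[i]) : \bar R :=
  'N[@leb2 R]_(2%:E)[(fun x => (cmod (f x))%:E) \_ (@disk R)]%E.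

(* Elements of L^2(B) are handled through representatives, whose values outside
   B are irrelevant; equality in L^2(B) is eq_L2. *)
Definition in_L2 (R : realType) (f : R * R -> R[i]) : Prop :=
  let B : set (measurableTypeR R * measurableTypeR R) := @disk R in
  [/\ measurable_fun B (fun x => complex.Re (f x)),
      measurable_fun B (fun x => complex.Im (f x)) &
      (disk_norm f < +oo)%E].

Definition eq_L2 (R : realType) (f g : R * R -> R[i]) : Prop :=
  {ae @leb2 R, forall x, @disk R x -> f x = g x}.

Definition in_span (R : realType) (I : choiceType) (A : set I)
    (psi : I -> R * R -> R[i]) (f : R * R -> R[i]) : Prop :=
  in_L2 f /\
  exists (J : {fset I}) (a : I -> R[i]),
    [set` J] `<=` A /\
    eq_L2 f (fun x => \sum_(i <- J) a i * psi i x).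

Definition disk_fourier (R : realType) (c : R) (q : R * R -> R[i])
    (x : R * R) : R[i] :=
  disk_int (fun y => cexpi (c * (x.1 * y.1 + x.2 * y.2)) * q y).

Definition polar (R : realType) (r t : R) : R * R := (r * cos t, r * sin t).

Definition twice_derivable (R : realType) (f : R -> R) (x : R) : Prop :=
  (\forall y \near x, derivable f y 1) /\ derivable (derive1 f) x 1.

Definition sturm_liouville (R : realType) (c : R) (f : R * R -> R)
    (r t : R) : R :=
  let F s := f (polar s t) in
  let G s := f (polar r s) in
  - (1 - r ^+ 2) * derive1n 2 F r - r^-1 * derive1 F r + 3 * r * derive1 F r
  - (r ^+ 2)^-1 * derive1n 2 G t + c ^+ 2 * r ^+ 2 * f (polar r t).

Definition circ (R : realType) (m l : nat) (t : R) : R :=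
  if m == 0%N then (Num.sqrt (2 * pi))^-1
  else if l == 1%N then cos (m%:R * t) / Num.sqrt pi
  else sin (m%:R * t) / Num.sqrt pi.

(* Indices (m, n, l) are of type nat * nat * nat. *)
Definition pswf_index : set (nat * nat * nat) :=
  [set i | if i.1.1 == 0%N then i.2 = 1%N else i.2 = 1%N \/ i.2 = 2%N].

(* psi i is constrained only for i in pswf_index, and only on the disk. *)
Record disk_pswf (R : realType) (c : R) := DiskPSWF {
  psi : nat * nat * nat -> R * R -> R;
  alpha : nat -> nat -> R[i];
  phi : nat -> nat -> R -> R;
  chi : nat -> nat -> R;

  psi_polar : forall m n l r t, pswf_index (m, n, l) -> 0 <= r < 1 ->
    psi (m, n, l) (polar r t) =
      r ^+ m * phi m n (2 * r ^+ 2 - 1) * circ m l t;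

  psi_fourier : forall m n l x, pswf_index (m, n, l) -> disk x ->
    disk_fourier c (fun y => (psi (m, n, l) y)%:C) x =
      alpha m n * (psi (m, n, l) x)%:C;

  psi_regular : forall m n l r t, pswf_index (m, n, l) -> 0 < r < 1 ->
    twice_derivable (fun s => psi (m, n, l) (polar s t)) r /\
    twice_derivable (fun s => psi (m, n, l) (polar r s)) t;
  psi_sturm : forall m n l r t, pswf_index (m, n, l) -> 0 < r < 1 ->
    sturm_liouville c (psi (m, n, l)) r t =
      chi m n * psi (m, n, l) (polar r t);
  chi_gt0 : forall m, 0 < chi m 0%N;
  chi_incr : forall m n1 n2, (n1 < n2)%N -> chi m n1 < chi m n2;

  psi_L2 : forall i, pswf_index i -> in_L2 (fun x => (psi i x)%:C);
  psi_orthonormal : forall i j, pswf_index i -> pswf_index j ->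
    disk_inner (fun x => (psi i x)%:C) (fun x => (psi j x)%:C) = (i == j)%:R;
  psi_complete : forall f, in_L2 f ->
    (forall i, pswf_index i -> disk_inner f (fun x => (psi i x)%:C) = 0) ->
    eq_L2 f (fun=> 0);

  alpha_neq0 : forall m n, alpha m n != 0;
  alpha_decr : forall m n1 n2, (n1 < n2)%N ->
    cmod (alpha m n2) < cmod (alpha m n1);
  (* the limit is along the cofinite filter of pairs (m, n) *)
  alpha_cvg0 : forall e : R, 0 < e ->
    exists N : nat, forall m n, (N <= m + n)%N -> cmod (alpha m n) < e
}.

Definition cutoff_index (R : realType) (c : R) (P : disk_pswf c) (eta : R) :
    set (nat * nat * nat) :=
  [set i | pswf_index i /\ eta < cmod (alpha P i.1.1 i.1.2)].

(* \sum_(i \in A) is a finite sum (and is 0 by convention when infinitely many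
   terms are nonzero); for eta > 0, cutoff_index P eta is finite by alpha_cvg0. *)
Definition spectral_cutoff (R : realType) (c : R) (P : disk_pswf c) (eta : R)
    (v : R * R -> R[i]) (x : R * R) : R[i] :=
  \sum_(i \in cutoff_index P eta)
     (alpha P i.1.1 i.1.2)^-1 * disk_inner v (fun y => (psi P i y)%:C)
       * (psi P i x)%:C.

(* Main.v *)
(* On the span of the psi_i with |alpha_i| > eta the Fourier operator is diagonal,
   so the error q^eta - q has coefficients <w, psi_i> / alpha_i, where
   w = u^delta - u.  Dividing by alpha_i costs at most 1 / eta, and Bessel's
   inequality bounds the sum of |<w, psi_i>|^2 by ||w||^2 <= delta^2. *)
Require Import Defs.
From HB Require Import structures.
From mathcomp Require Import all_boot all_order all_algebra.
From mathcomp Require Import finmap complex.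
From mathcomp Require Import ring lra.
From mathcomp Require Import all_classical all_reals all_analysis.
From mathcomp Require Import measurable_realfun.

Set Implicit Arguments.
Unset Strict Implicit.
Unset Printing Implicit Defensive.

Import Order.TTheory GRing.Theory Num.Theory.
Import numFieldNormedType.Exports.

Local Open Scope classical_set_scope.
Local Open Scope complex_scope.
(* Opened last so that _^* is always Num.conj, as in disk_inner, and never conjc. *)
Local Open Scope ring_scope.

Notation Re := complex.Re.
Notation Im := complex.Im.

(** * Real and imaginary parts of complex numbers *)

Section ReIm.
Variable R : realType.
Implicit Types z w : R[i].

Lemma ReD z w : Re (z + w) = Re z + Re w. Proof. by case: z w => ? ? []. Qed.
Lemma ImD z w : Im (z + w) = Im z + Im w. Proof. by case: z w => ? ? []. Qed.
Lemma ReM z w : Re (z * w) = Re z * Re w - Im z * Im w.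
Proof. by case: z w => ? ? []. Qed.
Lemma ImM z w : Im (z * w) = Re z * Im w + Im z * Re w.
Proof. by case: z w => ? ? []. Qed.
Lemma ReJ z : Re z^* = Re z. Proof. by case: z. Qed.
Lemma ImJ z : Im z^* = - Im z. Proof. by case: z. Qed.
Lemma complex_eq z w : Re z = Re w -> Im z = Im w -> z = w.
Proof. by case: z w => ? ? [? ?] /= -> ->. Qed.

Lemma normc_sqr z : cmod z ^+ 2 = Re z ^+ 2 + Im z ^+ 2.
Proof. by case: z => a b /=; rewrite sqr_sqrtr// addr_ge0// sqr_ge0. Qed.

Lemma mulcJ z : z * z^* = (cmod z ^+ 2)%:C.
Proof.
apply: complex_eq; first by rewrite normc_sqr ReM ReJ ImJ mulrN opprK.
by rewrite ImM ReJ ImJ /=; ring.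
Qed.

End ReIm.

(** * Complex-valued square-integrable functions on a measurable set, for an arbitrary measure *)

Section L2.
Context d (T : measurableType d) (R : realType).
Variables (mu : {measure set T -> \bar R}) (D : set T).
Hypothesis mD : measurable D.
Implicit Types f g h : T -> R[i].

(** Same shape as [disk_int], for general [mu] and [D], so that [disk_inner] is [inner] on the disk
    by mere conversion. *)
Definition cint f : R[i] :=
  Rintegral mu D (fun x => Re (f x)) +i* Rintegral mu D (fun x => Im (f x)).

Definition cintegrable f :=
  mu.-integrable D (EFin \o (fun x => Re (f x))) /\
  mu.-integrable D (EFin \o (fun x => Im (f x))).

Definition inner f g : R[i] := cint (fun x => f x * (g x)^*).

(** Stated through integrability of the squared modulus, the form that domination arguments use;
    [in_L2_L2] connects it with the norm-based [in_L2]. *)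
Definition L2 f := [/\ measurable_fun D (fun x => Re (f x)),
  measurable_fun D (fun x => Im (f x)) &
  mu.-integrable D (EFin \o (fun x => cmod (f x) ^+ 2))].

Lemma eq_cint f g : {in D, f =1 g} -> cint f = cint g.
Proof. by move=> fg; congr (_ +i* _); apply: eq_Rintegral => x /fg ->. Qed.

Lemma cintD f g : cintegrable f -> cintegrable g ->
  cint (fun x => f x + g x) = cint f + cint g.
Proof.
move=> [rf imf] [rg ig]; apply: complex_eq; rewrite ?ReD ?ImD /= -RintegralD//.
  by apply: eq_Rintegral => x _; rewrite ReD.
by apply: eq_Rintegral => x _; rewrite ImD.
Qed.

Lemma integrable_lin (u v : T -> R) a b : mu.-integrable D (EFin \o u) ->
  mu.-integrable D (EFin \o v) ->
  mu.-integrable D (EFin \o (fun x => a * u x + b * v x)).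
Proof.
move=> iu iv.
have := integrableD mD (integrableZl mD a iu) (integrableZl mD b iv).
exact: eq_integrable.
Qed.

Lemma Rintegral_lin (u v : T -> R) a b : mu.-integrable D (EFin \o u) ->
  mu.-integrable D (EFin \o v) ->
  Rintegral mu D (fun x => a * u x + b * v x) =
  a * Rintegral mu D u + b * Rintegral mu D v.
Proof.
move=> iu iv; rewrite RintegralD//; first by rewrite !RintegralZl.
- by have := integrableZl mD a iu; exact: eq_integrable.
- by have := integrableZl mD b iv; exact: eq_integrable.
Qed.

Lemma cintZ k f : cintegrable f -> cint (fun x => k * f x) = k * cint f.
Proof.
move=> [rf imf]; apply: complex_eq; rewrite ?ReM ?ImM /=.
  rewrite -mulNr -Rintegral_lin//.
  by apply: eq_Rintegral => x _; rewrite ReM mulNr.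
by rewrite -Rintegral_lin//; apply: eq_Rintegral => x _; rewrite ImM.
Qed.

Lemma cintJ f : cintegrable f -> cint (fun x => (f x)^*) = (cint f)^*.
Proof.
move=> [rf imf]; apply: complex_eq; rewrite ?ReJ ?ImJ /=.
  by apply: eq_Rintegral => x _; rewrite ReJ.
rewrite -mulN1r -RintegralZl//.
by apply: eq_Rintegral => x _; rewrite ImJ mulN1r.
Qed.

Lemma cint_ae f g : cintegrable f -> cintegrable g ->
  {ae mu, forall x, D x -> f x = g x} -> cint f = cint g.
Proof.
move=> [/integrableP[rf _] /integrableP[imf _]].
move=> [/integrableP[rg _] /integrableP[img _]] fg.
congr (_ +i* _); congr fine; apply: ae_eq_integral => //;
  by apply: filterS fg => x /[apply] /= ->.
Qed.

(** Both parts of the product are dominated by [|f|^2 + |g|^2], an elementary form of the inequality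
    between geometric and arithmetic means. *)
Lemma cintegrable_mulJ f g : L2 f -> L2 g ->
  cintegrable (fun x => f x * (g x)^*).
Proof.
move=> [rf imf nf] [rg img ng].
have ib := integrable_lin 1 1 nf ng.
split; apply: le_integrable ib => //.
- apply/measurable_EFinP.
  under eq_fun do rewrite ReM ReJ ImJ.
  apply: measurable_funB; apply: measurable_funM => //.
  exact: measurableT_comp.
- move=> x _ /=; rewrite lee_fin ReM ReJ ImJ !mul1r !normc_sqr.
  move: (Re (f x)) (Im (f x)) (Re (g x)) (Im (g x)) => a b p q.
  rewrite (@ger0_norm _ (_ + _ + _)) ?addr_ge0 ?sqr_ge0// ler_norml.
  (* These squares give [2|ap| <= a^2 + p^2] and [2|bq| <= b^2 + q^2], hence both signs of the
     bound. *)
  have := sqr_ge0 (a + p); have := sqr_ge0 (a - p).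
  have := sqr_ge0 (b + q); have := sqr_ge0 (b - q).
  by move=> *; apply/andP; split; nra.
- apply/measurable_EFinP.
  under eq_fun do rewrite ImM ReJ ImJ.
  apply: measurable_funD; apply: measurable_funM => //.
  exact: measurableT_comp.
- move=> x _ /=; rewrite lee_fin ImM ReJ ImJ !mul1r !normc_sqr.
  move: (Re (f x)) (Im (f x)) (Re (g x)) (Im (g x)) => a b p q.
  rewrite (@ger0_norm _ (_ + _ + _)) ?addr_ge0 ?sqr_ge0// ler_norml.
  have := sqr_ge0 (a + q); have := sqr_ge0 (a - q).
  have := sqr_ge0 (b + p); have := sqr_ge0 (b - p).
  by move=> *; apply/andP; split; nra.
Qed.

Lemma measurable_cmod_sqr f : measurable_fun D (fun x => Re (f x)) ->
  measurable_fun D (fun x => Im (f x)) ->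
  measurable_fun D (fun x => cmod (f x) ^+ 2).
Proof.
move=> rf imf; under eq_fun do rewrite normc_sqr.
by apply: measurable_funD; exact: measurable_funX.
Qed.

Lemma L2D f g : L2 f -> L2 g -> L2 (fun x => f x + g x).
Proof.
move=> [rf imf nf] [rg img ng].
have mr : measurable_fun D (fun x => Re (f x + g x)).
  by under eq_fun do rewrite ReD; exact: measurable_funD.
have mi : measurable_fun D (fun x => Im (f x + g x)).
  by under eq_fun do rewrite ImD; exact: measurable_funD.
(* The factors 2 come from the parallelogram law: [2|f|^2 + 2|g|^2 - |f + g|^2 = |f - g|^2 >= 0]. *)
split => //; apply: le_integrable (integrable_lin 2 2 nf ng) => //.
  by apply/measurable_EFinP; exact: measurable_cmod_sqr.
move=> x _ /=; rewrite lee_fin !ger0_norm ?sqr_ge0//; last first.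
  by rewrite addr_ge0// mulr_ge0// sqr_ge0.
rewrite !normc_sqr ReD ImD.
move: (Re (f x)) (Im (f x)) (Re (g x)) (Im (g x)) => a b p q.
by have := sqr_ge0 (a - p); have := sqr_ge0 (b - q); nra.
Qed.

Lemma L2Z k f : L2 f -> L2 (fun x => k * f x).
Proof.
move=> [rf imf nf]; split.
- under eq_fun do rewrite ReM.
  by apply: measurable_funB; exact: measurable_funM.
- under eq_fun do rewrite ImM.
  by apply: measurable_funD; exact: measurable_funM.
- have := integrableZl mD (cmod k ^+ 2) nf; apply: eq_integrable => // x _ /=.
  by rewrite -EFinM ComplexField.Normc.normcM exprMn.
Qed.

Lemma L2B f g : L2 f -> L2 g -> L2 (fun x => f x - g x).
Proof.
by move=> Lf Lg; under eq_fun do rewrite -mulN1r; apply: L2D => //; exact: L2Z.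
Qed.

Lemma L20 : L2 (fun=> 0).
Proof.
split; [exact: measurable_cst|exact: measurable_cst|].
have := integrable0 mu D; apply: eq_integrable => // x _.
by rewrite /comp normc_sqr /= expr0n addr0.
Qed.

(** The hypothesis is limited to members of [s] because [psi i] is constrained only at valid
    indices. *)
Lemma L2_sum (I : eqType) (s : seq I) (F : I -> T -> R[i]) :
  {in s, forall i, L2 (F i)} -> L2 (fun x => \sum_(i <- s) F i x).
Proof.
elim: s => [_|i s ih Fs].
  by under eq_fun do rewrite big_nil; exact: L20.
under eq_fun do rewrite big_cons; apply: L2D.
  by apply: Fs; rewrite mem_head.
by apply: ih => j js; apply: Fs; rewrite in_cons js orbT.
Qed.

Lemma L2_lin (I : eqType) (s : seq I) (a : I -> R[i]) (F : I -> T -> R[i]) :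
  {in s, forall i, L2 (F i)} -> L2 (fun x => \sum_(i <- s) a i * F i x).
Proof. by move=> Fs; apply: L2_sum => i /Fs; exact: L2Z. Qed.

Lemma inner_ae f g h : L2 f -> L2 g -> L2 h ->
  {ae mu, forall x, D x -> f x = g x} -> inner f h = inner g h.
Proof.
move=> Lf Lg Lh fg; apply: cint_ae; [exact: cintegrable_mulJ..|].
by apply: filterS fg => x /[apply] ->.
Qed.

Lemma innerC f g : L2 f -> L2 g -> inner g f = (inner f g)^*.
Proof.
move=> Lf Lg; rewrite -cintJ; last exact: cintegrable_mulJ.
by apply: eq_cint => x _; rewrite rmorphM/= conjCK mulrC.
Qed.

Lemma innerDl f g h : L2 f -> L2 g -> L2 h ->
  inner (fun x => f x + g x) h = inner f h + inner g h.
Proof.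
move=> Lf Lg Lh; rewrite -cintD; [|exact: cintegrable_mulJ..].
by apply: eq_cint => x _; rewrite mulrDl.
Qed.

Lemma innerZl k f h : L2 f -> L2 h ->
  inner (fun x => k * f x) h = k * inner f h.
Proof.
move=> Lf Lh; rewrite -cintZ; last exact: cintegrable_mulJ.
by apply: eq_cint => x _; rewrite mulrA.
Qed.

Lemma innerBl f g h : L2 f -> L2 g -> L2 h ->
  inner (fun x => f x - g x) h = inner f h - inner g h.
Proof.
move=> Lf Lg Lh; under [X in inner X]eq_fun do rewrite -mulN1r.
by rewrite innerDl ?innerZl ?mulN1r//; exact: L2Z.
Qed.

Lemma innerBr f g h : L2 f -> L2 g -> L2 h ->
  inner h (fun x => f x - g x) = inner h f - inner h g.
Proof.
move=> Lf Lg Lh; rewrite (innerC (L2B Lf Lg) Lh) innerBl// rmorphB.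
by rewrite (innerC Lf Lh) (innerC Lg Lh).
Qed.

Lemma inner_linl (I : eqType) (s : seq I) (a : I -> R[i])
    (F : I -> T -> R[i]) h : {in s, forall i, L2 (F i)} -> L2 h ->
  inner (fun x => \sum_(i <- s) a i * F i x) h =
  \sum_(i <- s) a i * inner (F i) h.
Proof.
move=> + Lh; elim: s => [_|i s ih Fs].
  (* For the empty sum, 0 is viewed as [0 * inner 0 h], so that homogeneity settles this case
     too. *)
  rewrite big_nil -[RHS](mul0r (inner (fun=> 0) h)) -innerZl//; last exact: L20.
  by apply: eq_cint => x _; rewrite big_nil mul0r.
have Li : L2 (F i) by apply: Fs; rewrite mem_head.
have Ls : {in s, forall i, L2 (F i)}.
  by move=> j js; apply: Fs; rewrite in_cons js orbT.
rewrite big_cons -ih// -innerZl// -innerDl//; [|exact: L2Z|exact: L2_lin].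
by apply: eq_cint => x _; rewrite big_cons.
Qed.

(** * Finite orthonormal families and Bessel's inequality *)

Definition orthonormal (I : eqType) (s : seq I) (e : I -> T -> R[i]) :=
  {in s &, forall i j, inner (e i) (e j) = (i == j)%:R}.

Lemma inner_coef (I : eqType) (s : seq I) (e : I -> T -> R[i])
    (a : I -> R[i]) j : uniq s -> {in s, forall i, L2 (e i)} ->
  orthonormal s e -> j \in s ->
  inner (fun x => \sum_(i <- s) a i * e i x) (e j) = a j.
Proof.
move=> us Ls oe js; rewrite inner_linl//; last exact: Ls.
rewrite (bigD1_seq j)//= oe// eqxx mulr1 big_seq_cond big1 ?addr0//.
by move=> i /andP[si ij]; rewrite oe// (negPf ij) mulr0.
Qed.

(** Parseval's identity for a finite expansion: expand the left factor, then each pairing of [e i]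
    with [S] is the conjugate of a coefficient. *)
Lemma inner_lin_self (I : eqType) (s : seq I) (e : I -> T -> R[i])
    (a : I -> R[i]) : uniq s -> {in s, forall i, L2 (e i)} ->
  orthonormal s e ->
  let S := fun x => \sum_(i <- s) a i * e i x in
  inner S S = \sum_(i <- s) a i * (a i)^*.
Proof.
move=> us Ls oe S; have LS : L2 S by exact: L2_lin.
rewrite {1}/S inner_linl//; apply: eq_big_seq => i si.
by rewrite (innerC LS (Ls _ si)) inner_coef.
Qed.

Lemma inner_self f : inner f f = (Rintegral mu D (fun x => cmod (f x) ^+ 2))%:C.
Proof.
apply: complex_eq => /=.
  by apply: eq_Rintegral => x _; rewrite mulcJ.
transitivity (Rintegral mu D (fun=> 0)); last first.
  by rewrite Rintegral_cst// mul0r.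
by apply: eq_Rintegral => x _; rewrite mulcJ.
Qed.

Lemma inner_self_ge0 f : 0 <= inner f f.
Proof.
by rewrite inner_self ler0c; apply: Rintegral_ge0 => x _; exact: sqr_ge0.
Qed.

(** With [S] the orthogonal projection of [f] onto the span, the pairings of [f] with [S] in either
    order equal [inner S S], so [inner f f - inner S S] is the squared norm of [f - S]. The order on
    [R[i]] compares real parts and asks for equal imaginary parts. *)
Lemma bessel (I : eqType) (s : seq I) (e : I -> T -> R[i]) f : uniq s ->
  {in s, forall i, L2 (e i)} -> orthonormal s e -> L2 f ->
  \sum_(i <- s) inner f (e i) * (inner f (e i))^* <= inner f f.
Proof.
move=> us Ls oe Lf; set S := fun x => \sum_(i <- s) inner f (e i) * e i x.
have LS : L2 S by exact: L2_lin.
have SS := inner_lin_self (fun i => inner f (e i)) us Ls oe.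
have Sf : inner S f = inner S S.
  rewrite {1}/S inner_linl// SS; apply: eq_big_seq => i si.
  by rewrite (innerC Lf (Ls _ si)).
have fS : inner f S = inner S S by rewrite (innerC LS Lf) Sf -innerC.
rewrite -SS -subr_ge0; have := inner_self_ge0 (fun x => f x - S x).
have LfS := L2B Lf LS.
by rewrite innerBl// !innerBr// Sf fS subrr subr0.
Qed.

End L2.

(** * The unit disk, its norm, and the Fourier operator as an inner product *)

Section disk.
Variable R : realType.
Implicit Types f g : R * R -> R[i].

Local Notation T := (measurableTypeR R * measurableTypeR R)%type.
Local Notation mu := (@leb2 R : {measure set T -> \bar R}).
Local Notation B := (@disk R : set T).

Lemma measurable_disk : measurable B.
Proof.
have -> : B = setT `&`
    (fun x : T => (x.1 : R) ^+ 2 + (x.2 : R) ^+ 2) @^-1` `]-oo, 1[.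
  by rewrite setTI; apply/seteqP; split => x /=; rewrite in_itv.
have mf : measurable_fun setT (fun x : T => (x.1 : R) ^+ 2 + (x.2 : R) ^+ 2).
  by apply: measurable_funD; apply: measurable_funX;
    [exact: measurable_fst|exact: measurable_snd].
exact: mf.
Qed.

(** The disk lies in a square of finite area. This makes bounded functions such as plane waves
    square-integrable. *)
Lemma leb2_disk_lty : (mu B < +oo)%E.
Proof.
have mI : measurable (`[-1, 1]%classic : set (measurableTypeR R)) by [].
have sub : B `<=` `[-1, 1] `*` `[-1, 1].
  move=> [a b]; rewrite /disk/= => ab; rewrite !in_itv/=.
  by split; apply/andP; split; nra.
have := le_measure mu (mem_set measurable_disk)
  (mem_set (measurableX mI mI)) sub.
move=> /le_lt_trans; apply; rewrite [ltLHS]product_measure1E//.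
rewrite /lebesgue_measure/= lebesgue_measure_itv/= lte_fin gtrN//.
by rewrite -EFinB -EFinM ltry.
Qed.

(* Exposes the measure structure of leb2, which the filter instance of {ae _, _}
   needs and which eq_L2 hides. *)
Lemma eq_L2E f g : eq_L2 f g = {ae mu, forall x, B x -> f x = g x}.
Proof. by []. Qed.

Lemma Lnorm_disk f :
  (\int[mu]_x (`|((fun x => (cmod (f x))%:E) \_ B) x| `^ 2)
   = \int[mu]_(x in B) (cmod (f x) ^+ 2)%:E)%E.
Proof.
rewrite [RHS]integral_mkcond; apply: eq_integral => x _; rewrite !patchE.
(* Off the disk the extension is 0, and so is its square. *)
case: ifPn => _; last by rewrite abse0 poweR0r.
have n0 : 0 <= cmod (f x) by case: (f x) => a b /=; exact: sqrtr_ge0.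
by rewrite gee0_abs ?lee_fin// poweR_EFin powR_mulrn.
Qed.

Lemma in_L2_L2 f : in_L2 f -> L2 mu B f.
Proof.
move=> [rf imf nf]; split => //; apply/integrableP; split.
  by apply/measurable_EFinP; exact: measurable_cmod_sqr.
under eq_integral do rewrite /= ger0_norm ?sqr_ge0//.
by rewrite -Lnorm_disk -poweR_Lnorm// poweR_lty.
Qed.

(** Membership in [L2] makes the integral finite, so passing from the extended-real norm to the
    real-valued [Rintegral] loses nothing. *)
Lemma disk_norm_inner f : L2 mu B f ->
  disk_norm f = (Num.sqrt (Re (inner mu B f f)))%:E.
Proof.
move=> [_ _ nf]; rewrite /disk_norm unlock Lnorm_disk.
rewrite inner_self; last exact: measurable_disk.
rewrite -[X in (X `^ _)%E]fineK; last first.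
  by apply: integrable_fin_num nf; exact: measurable_disk.
rewrite poweR_EFin powR12_sqrt//; apply: Rintegral_ge0 => x _; exact: sqr_ge0.
Qed.

Lemma eq_disk_norm f g : {in B, f =1 g} -> disk_norm f = disk_norm g.
Proof.
move=> fg; congr Lnorm; apply/funext => x; rewrite !patchE.
by case: ifPn => // /fg ->.
Qed.

(** Conjugated in advance, because [inner] conjugates its second argument: pairing with it restores
    the Fourier kernel. *)
Definition plane_wave (c : R) (x y : R * R) : R[i] :=
  (cexpi (c * (x.1 * y.1 + x.2 * y.2)))^*.

Lemma cmod_plane_wave c x y : cmod (plane_wave c x y) = 1.
Proof. by rewrite /= sqrrN cos2Dsin2 sqrtr1. Qed.

Lemma L2_plane_wave c x : L2 mu B (plane_wave c x).
Proof.
have mt :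
  measurable_fun B (fun y : T => c * (x.1 * (y.1 : R) + x.2 * (y.2 : R))).
  apply: measurable_funTS; apply: measurable_funM => //.
  by apply: measurable_funD; apply: measurable_funM => //.
split.
- exact: (measurableT_comp (continuous_measurable_fun (@continuous_cos R)) mt).
- have := measurableT_comp (continuous_measurable_fun (@continuous_sin R)) mt.
  exact: measurableT_comp.
- apply/integrableP; split.
    apply/measurable_EFinP; under eq_fun do rewrite cmod_plane_wave.
    exact: measurable_cst.
  under eq_integral do rewrite /comp cmod_plane_wave expr1n /= normr1.
  by rewrite integral_cst ?mul1e ?leb2_disk_lty//; exact: measurable_disk.
Qed.

(** Lets the Fourier operator inherit linearity and insensitivity to null sets from [inner]. *)
Lemma disk_fourierE c f x : disk_fourier c f x = inner mu B f (plane_wave c x).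
Proof. by apply: eq_cint => y _; rewrite /plane_wave conjCK mulrC. Qed.

End disk.

(** Decay of the eigenvalues at level [eta] yields [N] such that a modulus above [eta] forces
    [m + n < N]. *)
Lemma finite_cutoff_index (R : realType) (c : R) (P : disk_pswf c) (eta : R) :
  0 < eta -> finite_set (cutoff_index P eta).
Proof.
move=> /(alpha_cvg0 P)[N aN].
(* [I_3] suffices for the last component, as a valid [l] is 1 or 2. *)
apply: (@sub_finite_set _ _ ((`I_N `*` `I_N) `*` `I_3)); last first.
  by do 2 ?apply: finite_setX; exact: finite_II.
move=> [[m n] l] [/= il eta_lt].
have mnN : (m + n < N)%N.
  by rewrite ltnNge; apply/negP => /aN /(lt_trans eta_lt); rewrite ltxx.
do 2 ?split => /=.
- exact: leq_ltn_trans (leq_addr _ _) mnN.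
- exact: leq_ltn_trans (leq_addl _ _) mnN.
- by move: il; rewrite /pswf_index /=; case: ifP => _ => [->//|[]->].
Qed.

(** * Spectral expansions over the retained indices and the error of the cutoff *)

Section cutoff.
Variables (R : realType) (c eta : R) (P : disk_pswf c).
Hypothesis eta_gt0 : 0 < eta.

Local Notation T := (measurableTypeR R * measurableTypeR R)%type.
Local Notation mu := (@leb2 R : {measure set T -> \bar R}).
Local Notation B := (@disk R : set T).
Local Notation mB := (@measurable_disk R).

(** [fset_set] defaults to the empty set on infinite sets; [finite_cutoff_index] makes this a
    genuine enumeration. *)
Let s : seq (nat * nat * nat) := fset_set (cutoff_index P eta).
Let e i (x : R * R) := (psi P i x)%:C.
Let al (i : nat * nat * nat) := alpha P i.1.1 i.1.2.

Lemma mem_cutoff i : (i \in s) = (i \in cutoff_index P eta).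
Proof. by rewrite /s in_fset_set//; exact: finite_cutoff_index. Qed.

Lemma cutoff_pswf i : i \in s -> pswf_index i.
Proof. by rewrite mem_cutoff inE => -[]. Qed.

Lemma eta_lt_alpha i : i \in s -> eta < cmod (al i).
Proof. by rewrite mem_cutoff inE => -[]. Qed.

Lemma L2_psi i : pswf_index i -> L2 mu B (e i).
Proof. by move=> /(psi_L2 P) /in_L2_L2. Qed.

Lemma uniq_cutoff : uniq s. Proof. exact: fset_uniq. Qed.

Lemma L2_psi_cutoff : {in s, forall i, L2 mu B (e i)}.
Proof. by move=> i /cutoff_pswf /L2_psi. Qed.

Lemma orthonormal_psi : orthonormal mu B s e.
Proof. by move=> i j /cutoff_pswf ? /cutoff_pswf ?; exact: psi_orthonormal. Qed.

Lemma spectral_cutoffE v x : spectral_cutoff P eta v x =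
  \sum_(i <- s) (al i)^-1 * inner mu B v (e i) * e i x.
Proof.
by rewrite /spectral_cutoff fsbig_finite//; exact: finite_cutoff_index.
Qed.

(** Extending the coefficients by zero outside [J] replaces the unknown finite support by the fixed
    list [s]. *)
Lemma span_coef q : in_span (cutoff_index P eta) e q ->
  exists a, eq_L2 q (fun x => \sum_(i <- s) a i * e i x).
Proof.
move=> [_ [J [a [JA qE]]]].
exists (fun i => if i \in J then a i else 0).
rewrite !eq_L2E in qE *; apply: filterS qE => x /[apply] ->.
under [RHS]eq_bigr do rewrite (fun_if ( *%R^~ _)) mul0r.
rewrite -big_mkcond -[RHS]big_filter; apply: perm_big.
apply: uniq_perm; rewrite ?fset_uniq ?filter_uniq ?uniq_cutoff// => i.
rewrite mem_filter mem_cutoff; case: (boolP (i \in J)) => //= iJ.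
by apply/esym/mem_set/JA.
Qed.

(** The expansion of [q] holds only almost everywhere, yet its image is known at every point of the
    disk: integration ignores null sets, and each [e i] is an eigenfunction pointwise. *)
Lemma disk_fourier_span q a x : L2 mu B q ->
  eq_L2 q (fun y => \sum_(i <- s) a i * e i y) -> disk x ->
  disk_fourier c q x = \sum_(i <- s) al i * a i * e i x.
Proof.
move=> Lq qE dx; rewrite disk_fourierE.
rewrite (inner_ae mB Lq (L2_lin mB a L2_psi_cutoff) (L2_plane_wave c x) qE).
rewrite (inner_linl mB _ L2_psi_cutoff (L2_plane_wave c x)).
apply: eq_big_seq => -[[m n] l] si; rewrite -disk_fourierE.
by rewrite psi_fourier ?[al _ * _]mulrC ?mulrA//; exact: cutoff_pswf si.
Qed.

(** The exact data have coefficients [al i * a i], so [(al i)^-1 * inner v (e i) - a i] is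
    [(al i)^-1] times the coefficient of the noise [w]; Parseval then gives the squared norm. *)
Lemma cutoff_error q a v w : L2 mu B q -> L2 mu B v ->
  eq_L2 q (fun x => \sum_(i <- s) a i * e i x) ->
  w = (fun x => v x - \sum_(i <- s) al i * a i * e i x) ->
  let g x := spectral_cutoff P eta v x - q x in
  L2 mu B g /\
  inner mu B g g = \sum_(i <- s) ((al i)^-1 * inner mu B w (e i)) *
                                ((al i)^-1 * inner mu B w (e i))^*.
Proof.
move=> Lq Lv qE wE g.
pose b i := (al i)^-1 * inner mu B w (e i).
pose h x := \sum_(i <- s) b i * e i x.
have Lh : L2 mu B h := L2_lin mB b L2_psi_cutoff.
have Lg : L2 mu B g.
  apply: L2B; [exact: measurable_disk| |exact: Lq].
  rewrite (funext (spectral_cutoffE v)).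
  by apply: L2_lin; [exact: measurable_disk|exact: L2_psi_cutoff].
have gh : eq_L2 g h.
  rewrite !eq_L2E in qE *; apply: filterS qE => x /[apply] qx.
  rewrite /g qx spectral_cutoffE -sumrB.
  apply: eq_big_seq => i si; rewrite /b wE.
  have al0 : al i != 0 by exact: alpha_neq0.
  have Li := L2_psi_cutoff si.
  have LS := L2_lin mB (fun i => al i * a i) L2_psi_cutoff.
  rewrite (innerBl mB Lv LS Li).
  rewrite (inner_coef mB (fun i => al i * a i) uniq_cutoff L2_psi_cutoff
    orthonormal_psi si).
  by field.
(* [inner_ae] changes only the left argument; Hermitian symmetry brings the right one into its place
   and back. *)
split=> //; rewrite (inner_ae mB Lg Lh Lg gh) (innerC mB Lg Lh).
rewrite (inner_ae mB Lg Lh Lh gh) -(innerC mB Lh Lh).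
exact: (inner_lin_self mB b uniq_cutoff L2_psi_cutoff orthonormal_psi).
Qed.

(** Each retained eigenvalue exceeds [eta] in modulus, so every squared coefficient grows by at most
    [eta ^- 2]; Bessel's inequality bounds what remains. *)
Lemma cutoff_error_le w : L2 mu B w ->
  \sum_(i <- s) ((al i)^-1 * inner mu B w (e i)) *
                 ((al i)^-1 * inner mu B w (e i))^*
  <= (eta ^- 2)%:C * inner mu B w w.
Proof.
move=> Lw.
have bes := bessel mB uniq_cutoff L2_psi_cutoff orthonormal_psi Lw.
apply: (@le_trans _ _ ((eta ^- 2)%:C *
    \sum_(i <- s) inner mu B w (e i) * (inner mu B w (e i))^*)); last first.
  by apply: ler_wpM2l => //; rewrite ler0c invr_ge0 sqr_ge0.
rewrite mulr_sumr big_seq [leRHS]big_seq; apply: ler_sum => i si.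
rewrite !mulcJ ComplexField.Normc.normcM exprMn -rmorphM/= lecR.
apply: ler_wpM2r; first exact: sqr_ge0.
have eta_al := eta_lt_alpha si.
rewrite ComplexField.Normc.normcV exprVn lef_pV2 ?posrE ?exprn_gt0//.
  by rewrite ler_pXn2r ?nnegrE ?(ltW eta_al) ?(ltW (lt_trans _ eta_al)) ?ltW.
exact: lt_trans eta_al.
Qed.

End cutoff.

Theorem theorem4p2 (R : realType) (c eta delta : R) (P : disk_pswf c)
    (q u udelta : R * R -> R[i])
    (hc : 0 < c) (heta : 0 < eta) (hdelta : 0 <= delta)
    (hq : in_span (cutoff_index P eta) (fun i x => (psi P i x)%:C) q)
    (hu : forall x, disk x -> u x = disk_fourier c q x)
    (hudelta : in_L2 udelta)
    (hnoise : (disk_norm (fun x => udelta x - u x)%R <= delta%:E)%E) :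
  (disk_norm (fun x => spectral_cutoff P eta udelta x - q x)%R
     <= (delta / eta)%:E)%E.
Proof.
have mB := @measurable_disk R.
have [/in_L2_L2 Lq _] := hq; have Lv := in_L2_L2 hudelta.
have [a qE] := span_coef heta hq.
(* The noise, with [u] replaced by its eigenfunction expansion: the two agree on the whole disk, and
   the expansion is in [L2] as a finite sum. *)
set w : R * R -> R[i] := fun x =>
  udelta x - \sum_(i <- fset_set (cutoff_index P eta))
    alpha P i.1.1 i.1.2 * a i * (psi P i x)%:C.
have Lw := L2B mB Lv (L2_lin mB (fun i => alpha P i.1.1 i.1.2 * a i)
  (@L2_psi_cutoff _ _ _ P heta)).
have [Lg gE] := cutoff_error heta Lq Lv qE (erefl w).
have := cutoff_error_le P heta Lw.
move: hnoise; rewrite (@eq_disk_norm _ _ w); last first.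
  move=> x; rewrite inE => dx; rewrite /w hu//.
  by rewrite (disk_fourier_span heta Lq qE).
rewrite (disk_norm_inner Lw) (disk_norm_inner Lg) -gE !inner_self//.
rewrite -rmorphM/= lecR !lee_fin.
set G := Rintegral _ _ _; set W := Rintegral _ _ _ => W_le G_le.
(* Under the square root [eta ^- 2] becomes [eta^-1], as [eta] is positive, and [W_le] bounds the
   norm of the noise by [delta]. *)
apply: le_trans (ler_wsqrtr G_le) _.
rewrite sqrtrM ?invr_ge0 ?sqr_ge0// sqrtrV ?sqr_ge0// sqrtr_sqr gtr0_norm//.
by rewrite mulrC; apply: ler_wpM2r => //; rewrite invr_ge0 ltW.
Qed.
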